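(* Let $G$ be a finite subgroup of $\mathrm{SU}(2)$ and $\lambda: G\to \mathrm{U}(K)$ an irreducible representation. Let $\mathcal{C}$ be a $((j,K,d))$ spin code with encoding isometry $V:\mathbb{C}^K\to \mathcal{H}_j$ which is $(G,\lambda)$-covariant, i.e. $D^j(g)V = V\lambda(g)$ for all $g\in G$. Let $n=2j$. Then the image $\mathscr{D}(\mathcal{C})$ of the code under the Dicke state mapping is a permutationally invariant $n$-qubit code of dimension $K$ and distance $d$ (an $((n,K,d))$ code), and it is $G$-transversal: $g^{\otimes n}(\mathscr{D}V) = (\mathscr{D}V)\lambda(g)$ for all $g\in G$.
   Context: For a half-integer or integer $j\ge 0$, $\mathcal{H}_j$ denotes the spin-$j$ irreducible representation of $\mathrm{SU}(2)$, of dimension $2j+1$, with orthonormal $J_z$-eigenbasis $|j,m\rangle$, $m=-j,\dots,j$; $D^j(g)$ is the action of $g\in\mathrm{SU}(2)$ (Wigner $D$-operator). The spherical tensors are $T^k_q=\sqrt{\tfrac{2k+1}{2j+1}}\sum_{m=-j}^{j}C^{j\,m+q}_{k\,q,\,j\,m}|j,m+q\rangle\langle j,m|$ for $0\le k\le 2j$, $-k\le q\le k$ (Clebsch–Gordan coefficients; terms with $|m+q|>j$ vanish). A spin code is a $K$-dimensional subspace of $\mathcal{H}_j$; it is a $((j,K,d))$ spin code (distance $d$) if for all codewords $|\phi\rangle,|\psi\rangle$ and all $0\le k<d$, $-k\le q\le k$: $\langle\phi|T^k_q|\psi\rangle=c_{k,q}\langle\phi|\psi\rangle$ with $c_{k,q}$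 independent of the codewords. The Dicke state mapping $\mathscr{D}$ is the linear isometry $\mathcal{H}_j\to(\mathbb{C}^2)^{\otimes 2j}$ with $|j,m\rangle\mapsto |D^{2j}_{j-m}\rangle$, where $|D^n_w\rangle$ is the normalized uniform superposition of all $n$-qubit computational basis states of Hamming weight $w$. An $n$-qubit code (subspace) has distance $d$, written $((n,K,d))$ when of dimension $K$, if for all codewords $|\phi\rangle,|\psi\rangle$ and every $n$-qubit Pauli operator $E$ of weight $<d$ (weight = number of non-identity tensor factors), $\langle\phi|E|\psi\rangle=c_E\langle\phi|\psi\rangle$ with $c_E$ independent of the codewords. A multiqubit code is permutationally invariant if every codeword is invariant under all permutations of the qubits. *)

(* Defs.v *)
(* C : numClosedFieldType plays the role of the complex numbers. *)
From HB Require Import structures.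
From mathcomp Require Import all_boot all_order all_fingroup all_algebra.
From mathcomp Require Import mxrepresentation.
Set Implicit Arguments. Unset Strict Implicit. Unset Printing Implicit Defensive.
Import Order.TTheory GRing.Theory Num.Theory.
Local Open Scope ring_scope.

Section Defs.
Variable C : numClosedFieldType.

(* conjugate transpose *)
Definition adjmx m p (A : 'M[C]_(m, p)) : 'M[C]_(p, m) := (map_mx (fun z => z^*) A)^T.

(* Hermitian inner product <u|v> on column vectors *)
Definition cdot m (u v : 'cV[C]_m) : C := \sum_i (u i 0)^* * v i 0.

(* Factorials of half of a doubled (integer) argument:
   fact2 z = (z/2)! if z is even and >= 0, and 0 otherwise;
   ifact2 z = 1/(z/2)! if z is even and >= 0, and 0 otherwise. *)
Definition fact2 (z : int) : C :=
  if (0 <= z) && ~~ odd (absz z) then (((absz z)./2)`!)%:R else 0.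
Definition ifact2 (z : int) : C :=
  if (0 <= z) && ~~ odd (absz z) then (((absz z)./2)`!)%:R^-1 else 0.

(* Clebsch-Gordan coefficient C^{J M}_{j1 m1, j2 m2} (Racah's formula), all
   (half-)integer arguments given DOUBLED: tj1 = 2 j1, tm1 = 2 m1, etc.
   Outside the admissible ranges it evaluates to 0. *)
Definition cg (tj1 tm1 tj2 tm2 tJ tM : int) : C :=
  if tM == tm1 + tm2 then
    sqrtC ((tJ + 1)%:~R * fact2 (tJ + tj1 - tj2) * fact2 (tJ - tj1 + tj2)
              * fact2 (tj1 + tj2 - tJ) * ifact2 (tj1 + tj2 + tJ + 2))
  * sqrtC (fact2 (tJ + tM) * fact2 (tJ - tM) * fact2 (tj1 - tm1)
              * fact2 (tj1 + tm1) * fact2 (tj2 - tm2) * fact2 (tj2 + tm2))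
  * \sum_(t < (absz (tj1 + tj2 - tJ)%R).+1)
      ((-1) ^+ t * ifact2 (2 * t%:Z) * ifact2 (tj1 + tj2 - tJ - 2 * t%:Z)
       * ifact2 (tj1 - tm1 - 2 * t%:Z) * ifact2 (tj2 + tm2 - 2 * t%:Z)
       * ifact2 (tJ - tj2 + tm1 + 2 * t%:Z) * ifact2 (tJ - tj1 - tm2 + 2 * t%:Z))
  else 0.

(* Spin j = n/2. The basis vector of index i : 'I_n.+1 is |j, m> with m = j - i
   (doubled: 2m = n - 2i). *)

(* Spherical tensor T^k_q on H_j (n = 2j): entry (i', i) = <j,m'| T^k_q |j,m>. *)
Definition sph_tensor (n k : nat) (q : int) : 'M[C]_n.+1 :=
  \matrix_(i', i)
    if (n%:Z - 2 * (i' : nat)%:Z == n%:Z - 2 * (i : nat)%:Z + 2 * q) then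
      sqrtC ((2 * k + 1)%:R / (n + 1)%:R)
      * cg (2 * k%:Z) (2 * q) n%:Z (n%:Z - 2 * (i : nat)%:Z)
           n%:Z (n%:Z - 2 * (i' : nat)%:Z)
    else 0.

(* Wigner D-operator D^j(g) (n = 2j) for g : 'M_2, in the basis |j, j - i>
   (explicit Wigner formula: D^{1/2}(g) = g, with |1/2,1/2> = e_0). *)
Definition wignerD (n : nat) (g : 'M[C]_2) : 'M[C]_n.+1 :=
  \matrix_(i', i)
   (let p := (n - i)%N in let r := (i : nat) in
    let p' := (n - i')%N in let r' := (i' : nat) in
    sqrtC ((p'`! * r'`!)%:R / (p`! * r`!)%:R) *
    \sum_(k < p.+1)
      (if (k <= p')%N then
         ('C(p, k) * 'C(r, p' - k))%:R * g 0 0 ^+ k * g 1 0 ^+ (p - k)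
           * g 0 1 ^+ (p' - k) * g 1 1 ^+ (r - (p' - k))
       else 0)).

(* ((j,K,d)) spin code given by an encoding isometry V : C^K -> H_j (n = 2j);
   codewords are V x.  Knill-Laflamme condition for all T^k_q, 0 <= k < d. *)
Definition spin_code_distance (n K d : nat) (V : 'M[C]_(n.+1, K)) : Prop :=
  forall (k : nat) (q : int), (k < d)%N -> (k <= n)%N -> `|q| <= k%:Z ->
    exists c : C, forall x y : 'cV[C]_K,
      cdot (V *m x) (sph_tensor n k q *m (V *m y)) = c * cdot (V *m x) (V *m y).

(* n-qubit states: functions on bit strings s : 'I_n -> bool (s i = qubit i). *)
Definition bits (n : nat) := {ffun 'I_n -> bool}.
Definition qvec (n : nat) := bits n -> C.
Definition qop (n : nat) := bits n -> bits n -> C.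

Definition qdot n (phi psi : qvec n) : C := \sum_s (phi s)^* * psi s.
Definition qapply n (A : qop n) (psi : qvec n) : qvec n :=
  fun s => \sum_t A s t * psi t.

Definition bidx (b : bool) : 'I_2 := inord (nat_of_bool b).

(* tensor product of single-qubit operators f i (given as 2x2 matrices) *)
Definition qtensor n (f : 'I_n -> 'M[C]_2) : qop n :=
  fun s t => \prod_i f i (bidx (s i)) (bidx (t i)).

(* g^{\otimes n} *)
Definition tpow n (g : 'M[C]_2) : qop n := qtensor (fun _ : 'I_n => g).

(* single-qubit Paulis: 0 = I, 1 = X, 2 = Y, 3 = Z *)
Definition pauli1 (p : 'I_4) : 'M[C]_2 :=
  \matrix_(a, b)
    match (p : nat) with
    | 0%N => (a == b)%:R
    | 1%N => (a != b)%:R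
    | 2%N => if (a == 0) && (b == 1) then - 'i
             else if (a == 1) && (b == 0) then 'i else 0
    | _ => if a == b then (if a == 0 then 1 else -1) else 0
    end.

Definition pauli n (P : 'I_n -> 'I_4) : qop n := qtensor (fun i => pauli1 (P i)).
Definition pauli_weight n (P : 'I_n -> 'I_4) : nat := #|[pred i | P i != 0]|.

(* n-qubit code given by an encoding map W : C^K -> (C^2)^{\otimes n} *)
Definition qubit_code_distance (n K d : nat) (W : 'cV[C]_K -> qvec n) : Prop :=
  forall P : 'I_n -> 'I_4, (pauli_weight P < d)%N ->
    exists c : C, forall x y : 'cV[C]_K,
      qdot (W x) (qapply (pauli P) (W y)) = c * qdot (W x) (W y).

Definition hamming n (s : bits n) : nat := #|[pred i | s i]|.

(* normalized Dicke state |D^n_w> *)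
Definition dicke_state n (w : nat) : qvec n :=
  fun s => if hamming s == w then (sqrtC ('C(n, w))%:R)^-1 else 0.

(* Dicke state mapping: |j, m> = e_i  |->  |D^{2j}_{j-m}> = |D^n_i> *)
Definition dicke n (psi : 'cV[C]_n.+1) : qvec n :=
  fun s => \sum_(i < n.+1) psi i 0 * @dicke_state n i s.

Definition perm_invariant n (psi : qvec n) : Prop :=
  forall (sigma : 'S_n) (s : bits n), psi [ffun i => s (sigma i)] = psi s.

End Defs.

(* Main.v *)
Require Import Defs.
From HB Require Import structures.
From mathcomp Require Import all_boot all_order all_fingroup all_algebra.
From mathcomp Require Import mxrepresentation.
From mathcomp Require Import zify ring.
Import Order.TTheory GRing.Theory Num.Theory.
Local Open Scope ring_scope.
Set Implicit Arguments. Unset Strict Implicit. Unset Printing Implicit Defensive.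

(** On the symmetric subspace an operator E of weight w acts, in the Dicke
    basis, as a combination of the matrices U(w, a, b), 0 <= a, b <= w, that
    compress the matrix units |1^a 0^(w-a)><1^b 0^(w-b)| tensored with the
    identity on the other n - w qubits.  Racah's formula says that T^k_q is, up
    to a nonzero factor, an alternating sum with positive weights of the
    U(k, a, b) on the diagonal b - a = q, while Pascal's rule gives
    U(k, a, b) + U(k, a+1, b+1) = U(k-1, a, b).  So modulo level k - 1 the
    U(k, a, b) on one diagonal agree up to alternating signs, T^k_q becomes a
    nonzero multiple of each of them, and by induction every U(w, a, b) is a
    combination of the T^k_q with k <= w: the Knill-Laflamme conditions for
    spherical tensors of rank < d give those for Paulis of weight < d.
    Transversality compares Wigner's formula with the coefficients of
    (g00 X + g01)^(n-i') (g10 X + g11)^i', where X marks the zeros of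
    the input bit string. *)

(** * Generating polynomials over bit strings *)

(** Expanding the product chooses a letter [t l] at each position, and ['X] counts the positions
    where that letter is [b]. *)
Lemma coef_prod_linear (R : comNzRingType) n (f : 'I_n -> bool -> R) b i :
  (\prod_l ((f l b)%:P * 'X + (f l (~~ b))%:P))`_i =
  \sum_(t : bits n | #|[pred l | t l == b]| == i) \prod_l f l (t l).
Proof.
have -> : \prod_l ((f l b)%:P * 'X + (f l (~~ b))%:P) =
          \prod_l \sum_c (f l c) *: 'X^(c == b).
  apply: eq_bigr => l _.
  by rewrite big_bool; case: b => /=; rewrite expr0 expr1 -!mul_polyC mulr1 // addrC.
rewrite bigA_distr_bigA coef_sum [RHS]big_mkcond; apply: eq_bigr => t _.
rewrite scaler_prod -expr_sum -big_mkcond sum1_card coefZ coefXn eq_sym.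
by case: eqP; rewrite ?mulr1 ?mulr0.
Qed.

Lemma hamming_lt n (s : bits n) : (hamming s < n.+1)%N.
Proof. by rewrite ltnS -[X in (_ <= X)%N]card_ord; apply: max_card. Qed.

Lemma card_zeros n (s : bits n) : #|[pred l | s l == false]| = (n - hamming s)%N.
Proof.
have e : (hamming s + #|[predC [pred i | s i]]| = n)%N by rewrite cardC card_ord.
rewrite -[X in _ = (X - _)%N]e addKn.
by apply: eq_card => l; rewrite !inE eqbF_neg.
Qed.

Lemma card_ones n (s : bits n) : #|[pred l | s l == true]| = hamming s.
Proof. by apply: eq_card => l; rewrite !inE eqb_id. Qed.

Lemma prod_bits (R : comNzRingType) n (s : bits n) (F : bool -> R) :
  \prod_l F (s l) = F false ^+ (n - hamming s) * F true ^+ hamming s.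
Proof.
rewrite (bigID [pred l | s l == false]) /= -card_zeros -card_ones; congr (_ * _).
  by rewrite -prodr_const; apply: eq_bigr => l /eqP ->.
rewrite -prodr_const; apply: eq_big => l; first by rewrite !inE; case: (s l).
by case: (s l).
Qed.

Lemma bidxE (b : bool) : bidx b = if b then 1 else 0.
Proof. by apply: val_inj; rewrite /bidx /= inordK; case: b. Qed.

Lemma coef_linear_exp (R : comNzRingType) (a b : R) m i :
  ((a%:P * 'X + b%:P) ^+ m)`_i = a ^+ i * b ^+ (m - i) *+ 'C(m, i).
Proof.
rewrite addrC exprDn coef_sum.
have E (k : 'I_m.+1) : (b%:P ^+ (m - k) * (a%:P * 'X) ^+ k *+ 'C(m, k))`_i =
    if i == k :> nat then a ^+ i * b ^+ (m - i) *+ 'C(m, i) else 0.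
  rewrite coefMn exprMn mulrA -!rmorphXn -rmorphM coefCM coefXn /=.
  by case: eqP => [->|]; rewrite ?mulr1 ?mulr0 ?mul0rn // mulrC.
rewrite (eq_bigr _ (fun k _ => E k)) -big_mkcond /=.
case: (ltnP i m.+1) => im.
  by rewrite (big_pred1 (Ordinal im)) // => k; rewrite eq_sym -val_eqE.
rewrite big_pred0 ?bin_small ?mulr0n // => k.
by apply/eqP => ik; move: (ltn_ord k); rewrite -ik ltnNge im.
Qed.

Section Dicke.
Variable C : numClosedFieldType.

(** * Dicke states and their amplitudes *)

Definition dicke_amp n w : C := (sqrtC ('C(n, w))%:R)^-1.

Lemma sqrtC_nat_gt0 m : (0 < m)%N -> 0 < sqrtC (m%:R : C).
Proof. by rewrite sqrtC_gt0 ltr0n. Qed.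

Lemma conj_dicke_amp n w : (dicke_amp n w)^* = dicke_amp n w.
Proof. by rewrite geC0_conj // invr_ge0 sqrtC_ge0 ler0n. Qed.

Lemma dicke_stateE n w (s : bits n) :
  dicke_state C w s = if hamming s == w then dicke_amp n w else 0.
Proof. by []. Qed.

Lemma dickeE n (u : 'cV[C]_n.+1) (s : bits n) :
  dicke u s = u (inord (hamming s)) 0 * dicke_amp n (hamming s).
Proof.
rewrite /dicke (bigD1 (inord (hamming s))) //= inordK ?hamming_lt //.
rewrite dicke_stateE eqxx big1 ?addr0 // => i ne.
rewrite dicke_stateE; case: eqP => [e|_]; last by rewrite mulr0.
by case/eqP: ne; apply: val_inj; rewrite /= inordK ?hamming_lt.
Qed.

Lemma dicke_perm_invariant n (u : 'cV[C]_n.+1) : perm_invariant (dicke u).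
Proof.
move=> sigma s; rewrite !dickeE.
suff -> : hamming [ffun i => s (sigma i)] = hamming s by [].
rewrite /hamming -[RHS]cardsE -(card_preimset _ (@perm_inj _ sigma)).
by apply: eq_card => i; rewrite !inE ffunE.
Qed.

(** The square roots in Wigner's and in Racah's formula are built from this factor, which is the
    Dicke amplitude up to the square root of n!. *)
Definition sqrt_facts n i : C := sqrtC ((i`! * (n - i)`!)%:R).

Lemma dicke_ampE n i : (i <= n)%N -> dicke_amp n i = sqrt_facts n i / sqrtC (n`!)%:R.
Proof.
move=> le; apply: (mulIf (x := sqrtC (n`!)%:R)).
  by rewrite lt0r_neq0 // sqrtC_nat_gt0 // fact_gt0.
rewrite mulfVK; last by rewrite lt0r_neq0 // sqrtC_nat_gt0 // fact_gt0.
rewrite -(bin_fact le) natrM sqrtCM ?nnegrE ?ler0n // mulrA mulVf ?mul1r //.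
by rewrite lt0r_neq0 // sqrtC_nat_gt0 // bin_gt0.
Qed.

Lemma sqrt_facts_neq0 n i : sqrt_facts n i != 0.
Proof. by rewrite lt0r_neq0 // sqrtC_nat_gt0 // muln_gt0 !fact_gt0. Qed.

Lemma sqrt_facts_sqr n i : sqrt_facts n i ^+ 2 = (i`! * (n - i)`!)%:R.
Proof. exact: sqrtCK. Qed.

(** * Wigner's formula and transversality *)

(** Both sides are p! (n-p)! p'! (n-p')! over the factorials of the four cells k, p-k, p'-k,
    n-p-p'+k of a 2x2 table with margins p and p'. If the last cell is negative, both vanish. *)
Lemma bin_swap n p p' k : (p <= n)%N -> (p' <= n)%N -> (k <= p)%N -> (k <= p')%N ->
  ('C(p', k) * 'C(n - p', p - k) * (p`! * (n - p)`!) =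
   'C(p, k) * 'C(n - p, p' - k) * (p'`! * (n - p')`!))%N.
Proof.
move=> pn p'n kp kp'.
case: (leqP (p - k) (n - p')) => h; last first.
  by rewrite (@bin_small (n - p')) ?(@bin_small (n - p)) ?muln0 ?mul0n //; lia.
have h' : (p' - k <= n - p)%N by lia.
rewrite -(bin_fact kp) -(bin_fact kp') -(bin_fact h) -(bin_fact h').
have -> : (n - p' - (p - k) = n - p - (p' - k))%N by lia.
by ring.
Qed.

(** The binomials here come from the row index i', those in [wignerD] from the column index i.
    [bin_swap] exchanges them at the cost of a factorial ratio, which the amplitudes and the square
    root absorb. *)
Lemma coef_wigner n (g : 'M[C]_2) (i' i : 'I_n.+1) :
  dicke_amp n i * \sum_(k < (n - i).+1)
    (g 0 0 ^+ k * g 0 1 ^+ (n - i' - k) *+ 'C(n - i', k)) *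
    (g 1 0 ^+ (n - i - k) * g 1 1 ^+ (i' - (n - i - k)) *+ 'C(i', n - i - k))
  = dicke_amp n i' * wignerD n g i' i.
Proof.
have le_i : (i <= n)%N by rewrite -ltnS.
have le_i' : (i' <= n)%N by rewrite -ltnS.
(* With R the factorial ratio, the amplitudes at i' and i have quotient sqrt R. *)
have ampw : dicke_amp n i' * sqrtC (((n - i')`! * i'`!)%:R / ((n - i)`! * i`!)%:R) =
    dicke_amp n i * (((n - i')`! * i'`!)%:R / ((n - i)`! * i`!)%:R).
  rewrite sqrtCM ?nnegrE ?invr_ge0 ?ler0n // rootCV ?ler0n // !dicke_ampE //.
  rewrite !(mulnC (n - _)`!) -!sqrt_facts_sqr -!/(sqrt_facts _ _).
  rewrite !sqrCK ?sqrtC_ge0 ?ler0n //; field; rewrite sqrt_facts_neq0 /=.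
  by rewrite lt0r_neq0 // sqrtC_nat_gt0 // fact_gt0.
rewrite mxE /= mulrA ampw -mulrA; congr (_ * _); rewrite mulr_sumr.
apply: eq_bigr => k _; have lek : (k <= n - i)%N by rewrite -ltnS.
case: (leqP k (n - i')) => lek'; last first.
  by rewrite [X in _ *+ X]bin_small // mulr0n mul0r mulr0.
have := bin_swap (leq_subr i n) (leq_subr i' n) lek lek'.
rewrite !subKn // => bs.
(* Beyond this bound a binomial vanishes on each side, so truncated subtraction in the exponents
   does no harm. *)
case: (leqP (n - i - k) i') => h; last first.
  rewrite (@bin_small i') // mulr0n mulr0 (@bin_small i) ?muln0 ?mul0r ?mulr0 //.
  lia.
have -> : (i' - (n - i - k) = i - (n - i' - k))%N by lia.
have nz : ((n - i)`! * i`!)%:R != 0 :> C.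
  by rewrite pnatr_eq0 -lt0n muln_gt0 !fact_gt0.
rewrite -[_ *+ 'C(n - i', k)]mulr_natr -[_ *+ 'C(i', _)]mulr_natr.
apply: (mulIf nz); rewrite -[LHS]mulrA.
transitivity (('C(n - i', k) * 'C(i', n - i - k) * ((n - i)`! * i`!))%:R *
  (g 0 0 ^+ k * g 0 1 ^+ (n - i' - k) * (g 1 0 ^+ (n - i - k) * g 1 1 ^+ (i - (n - i' - k))))).
  by rewrite !natrM; ring.
rewrite bs mulrAC -[_ / _ * _]mulrAC -mulrA mulfVK // !natrM; ring.
Qed.

Lemma sum_by_hamming (R : nmodType) n (F : bits n -> R) :
  \sum_t F t = \sum_(i < n.+1) \sum_(t | hamming t == i) F t.
Proof.
by rewrite (partition_big (fun t : bits n => Ordinal (hamming_lt t)) predT).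
Qed.

Lemma dicke_wignerD n (g : 'M[C]_2) (u : 'cV[C]_n.+1) :
  qapply (@tpow C n g) (dicke u) =1 dicke (wignerD n g *m u).
Proof.
move=> s; rewrite dickeE mxE /qapply sum_by_hamming mulr_suml.
apply: eq_bigr => i _; set i' := inord _.
have hi' : hamming s = i' by rewrite /i' inordK ?hamming_lt.
have le_i : (i <= n)%N by rewrite -ltnS.
rewrite hi' mulrAC [_ * dicke_amp n i']mulrC -coef_wigner [dicke_amp n i * _]mulrC mulrAC -mulrA.
transitivity ((\sum_(t : bits n | hamming t == i) tpow g s t) * (u i 0 * dicke_amp n i)).
  rewrite mulr_suml; apply: eq_bigr => t /eqP ht.
  by rewrite dickeE ht inord_val.
congr (_ * _).
(* Marking zeros turns weight i into the coefficient of ['X^(n - i)], in agreement with the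
   exponents of [wignerD]. *)
have := coef_prod_linear (fun l b => g (bidx (s l)) (bidx b)) false (n - i)%N.
rewrite -/(bits n) => E.
transitivity (\sum_(t : bits n | #|[pred l | t l == false]| == (n - i)%N) tpow g s t).
  apply: eq_bigl => t; rewrite card_zeros.
  have := hamming_lt t; rewrite ltnS => ht.
  by apply/eqP/eqP; lia.
rewrite /tpow /qtensor -E.
rewrite (prod_bits s (fun b => (g (bidx b) (bidx false))%:P * 'X
                               + (g (bidx b) (bidx (~~ false)))%:P)).
rewrite !bidxE /= hi' coefM; apply: eq_bigr => k _.
by rewrite !coef_linear_exp.
Qed.

(** * Isometry, and compression of operators to the Dicke basis *)

Lemma card_hamming n i : #|[pred s : bits n | hamming s == i]| = 'C(n, i).
Proof.
apply/eqP; rewrite -(eqr_nat int); apply/eqP.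
have := coef_prod_linear (fun (_ : 'I_n) _ => 1 : int) true i.
rewrite /= prodr_const card_ord coef_linear_exp !expr1n mulr1 => ->.
rewrite -sum1_card natr_sum; apply: eq_big => t; first by rewrite inE card_ones.
by rewrite big1.
Qed.

Lemma dicke_isometry n (u v : 'cV[C]_n.+1) : qdot (dicke u) (dicke v) = cdot u v.
Proof.
rewrite /qdot sum_by_hamming; apply: eq_bigr => i _.
have le_i : (i <= n)%N by rewrite -ltnS.
transitivity (\sum_(t : bits n | hamming t == i) ((u i 0)^* * v i 0 * dicke_amp n i ^+ 2)).
  apply: eq_bigr => t /eqP ht; rewrite !dickeE ht inord_val rmorphM /= conj_dicke_amp.
  by ring.
rewrite sumr_const card_hamming -mulr_natr -mulrA.
rewrite /dicke_amp exprVn sqrtCK mulVf ?mulr1 //.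
by rewrite pnatr_eq0 -lt0n bin_gt0.
Qed.

(** The matrix elements of [E] between Dicke states. *)
Definition dicke_op n (E : qop C n) : 'M[C]_n.+1 :=
  \matrix_(i', i) (dicke_amp n i' * dicke_amp n i *
    \sum_(s : bits n | hamming s == i') \sum_(t : bits n | hamming t == i) E s t).

Lemma qdot_dicke_op n (E : qop C n) (u v : 'cV[C]_n.+1) :
  qdot (dicke u) (qapply E (dicke v)) = cdot u (dicke_op E *m v).
Proof.
rewrite /qdot sum_by_hamming; apply: eq_bigr => i' _.
transitivity (\sum_(s : bits n | hamming s == i') \sum_(i < n.+1)
    \sum_(t : bits n | hamming t == i)
      (u i' 0)^* * v i 0 * (dicke_amp n i' * dicke_amp n i) * E s t).
  apply: eq_bigr => s /eqP hs; rewrite /qapply sum_by_hamming mulr_sumr.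
  apply: eq_bigr => i _; rewrite mulr_sumr; apply: eq_bigr => t /eqP ht.
  by rewrite !dickeE hs ht !inord_val rmorphM /= conj_dicke_amp; ring.
rewrite exchange_big mxE mulr_sumr; apply: eq_bigr => i _ /=.
rewrite mxE; under eq_bigr do rewrite -mulr_sumr.
by rewrite -mulr_sumr; ring.
Qed.

(* The compression of |1^a 0^(k-a)><1^b 0^(k-b)| (x) id to the Dicke basis. *)
Definition dicke_unit n k a b : 'M[C]_n.+1 :=
  \matrix_(i', i) (if (i' + b == i + a)%N && (b <= i)%N
                   then dicke_amp n i' * dicke_amp n i * ('C(n - k, i - b))%:R else 0).

(** Split the identity on one of the n - k free qubits into |1><1| + |0><0|. *)
Lemma dicke_unit_pascal n k a b : (k < n)%N ->
  dicke_unit n k a b = dicke_unit n k.+1 a.+1 b.+1 + dicke_unit n k.+1 a b.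
Proof.
move=> kn; apply/matrixP => i' i; rewrite !mxE !addnS eqSS.
case: eqP => [e|_] /=; last by rewrite addr0.
have -> : (n - k = (n - k.+1).+1)%N by lia.
(* At i = b the raised unit fails its range test and the other two binomials are 1. *)
case: ltngtP => [bi|_|bi] /=; last 2 first.
- by rewrite addr0.
- by rewrite bi subnn !bin0 add0r.
have -> : (i - b = (i - b.+1).+1)%N by lia.
by rewrite binS natrD mulrDr addrC.
Qed.

(** * Racah's formula for the spherical tensors *)

Lemma fact2_double (z : int) m : z = 2 * m%:Z -> fact2 C z = (m`!)%:R.
Proof. by move=> ->; rewrite /fact2 abszM /= mul2n odd_double doubleK. Qed.

Lemma ifact2_double (z : int) m : z = 2 * m%:Z -> ifact2 C z = (m`!)%:R^-1.
Proof. by move=> ->; rewrite /ifact2 abszM /= mul2n odd_double doubleK. Qed.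

Lemma ifact2_neg (z : int) : z < 0 -> ifact2 C z = 0.
Proof. by rewrite /ifact2 ltNge => /negbTE ->. Qed.

(** The unsigned part of Racah's t-th summand that is the same for all matrix entries. The guard
    excludes factorials of negative numbers. *)
Definition racah_weight k (q : int) (t : nat) : C :=
  let a := (k%:Z - t%:Z - q)%R in
  if (0 <= a) && (a <= k%:Z) then
    ((t`!)%:R * ((k - t)`!)%:R * ((absz a)`!)%:R * ((k - absz a)`!)%:R)^-1
  else 0.

Lemma fact_neq0 m : (m`!)%:R != 0 :> C.
Proof. by rewrite pnatr_eq0 -lt0n fact_gt0. Qed.

(** For j2 = J = n/2 the two reciprocal factorials in Racah's sum that involve n and i combine to
    C(n-k, i-(k-t)) / (n-k)!, the binomial of [dicke_unit] at b = k - t. The other four form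
    [racah_weight]. *)
Lemma sph_tensorE n k (q : int) : (k <= n)%N -> `|q| <= k%:Z ->
  exists2 c : C, c != 0 & sph_tensor C n k q =
    c *: \sum_(t < k.+1) ((-1) ^+ t * racah_weight k q t)
                           *: dicke_unit n k (absz (k%:Z - t%:Z - q)%R) (k - t).
Proof.
move=> kn qk.
(* [c1] normalizes T^k_q, [c2] is the first square root of [cg], and [c3] is the part of the second
   one that depends on q. *)
pose c1 : C := sqrtC ((2 * k + 1)%:R / (n + 1)%:R).
pose c2 : C := sqrtC ((n%:Z + 1)%:~R * (k`!)%:R * ((n - k)`!)%:R * (k`!)%:R
                  * ((n + k + 1)`!)%:R^-1).
pose c3 : C := sqrtC (((absz (k%:Z - q)%R)`!)%:R * ((absz (k%:Z + q)%R)`!)%:R).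
exists (c1 * c2 * c3 * (n`!)%:R / ((n - k)`!)%:R).
  rewrite !mulf_neq0 ?invr_eq0 ?fact_neq0 // lt0r_neq0 // sqrtC_gt0.
  - by rewrite divr_gt0 // ltr0n addn1.
  - by rewrite !mulr_gt0 ?invr_gt0 ?ltr0n ?fact_gt0 ?addn1.
  - by rewrite mulr_gt0 ?ltr0n ?fact_gt0.
apply/matrixP => i' i; rewrite !mxE summxE.
have le_i : (i <= n)%N by rewrite -ltnS.
have le_i' : (i' <= n)%N by rewrite -ltnS.
case: eqP => [e|ne]; last first.
  rewrite big1 ?mulr0 // => t _; rewrite !mxE /racah_weight.
  case: ifP => [/andP[h1 h2]|]; last by rewrite mulr0 mul0r.
  rewrite ifF ?mulr0 //; apply/negP => /andP[/eqP h3 h4].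
  by apply: ne; move: (ltn_ord t); lia.
rewrite /cg ifT; last by apply/eqP; lia.
rewrite (@fact2_double _ k); last by lia.
rewrite (@fact2_double _ (n - k)); last by lia.
rewrite (@fact2_double _ k); last by lia.
rewrite (@ifact2_double _ (n + k + 1)); last by lia.
rewrite (@fact2_double _ (n - i')); last by lia.
rewrite (@fact2_double _ i'); last by lia.
rewrite (@fact2_double _ (absz (k%:Z - q)%R)); last by lia.
rewrite (@fact2_double _ (absz (k%:Z + q)%R)); last by lia.
rewrite (@fact2_double _ i); last by lia.
rewrite (@fact2_double _ (n - i)); last by lia.
rewrite -/c1 -/c2.
(* The factorials of i and i' left after splitting off [c3] are two Dicke amplitudes times n!. *)
set S := sqrtC _; have {S}-> : S = c3 * (dicke_amp n i' * dicke_amp n i * (n`!)%:R).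
  have nz : sqrtC (n`!)%:R != 0 :> C by rewrite lt0r_neq0 // sqrtC_nat_gt0 // fact_gt0.
  have -> : dicke_amp n i' * dicke_amp n i * (n`!)%:R =
      sqrt_facts n i' * sqrt_facts n i.
    by rewrite !dicke_ampE // -[in X in _ * X = _](sqrtCK (n`!)%:R); field.
  rewrite /S /c3 /sqrt_facts -!sqrtCM ?nnegrE -?natrM ?ler0n //.
  by congr (sqrtC _%:R); ring.
set F := fun t : nat =>
      (-1) ^+ t * ifact2 C (2 * t%:Z) * ifact2 C (2 * k%:Z + n%:Z - n%:Z - 2 * t%:Z) *
      ifact2 C (2 * k%:Z - 2 * q - 2 * t%:Z) *
      ifact2 C (n%:Z + (n%:Z - 2 * i%:Z) - 2 * t%:Z) *
      ifact2 C (n%:Z - n%:Z + 2 * q + 2 * t%:Z) *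
      ifact2 C (n%:Z - 2 * k%:Z - (n%:Z - 2 * i%:Z) + 2 * t%:Z).
(* [cg] bounds its sum by a doubled argument, so t runs up to 2k; the terms with t > k vanish. *)
have -> : absz (2 * k%:Z + n%:Z - n%:Z)%R = (k + k)%N by lia.
rewrite -(big_mkord xpredT F) (@big_cat_nat _ _ _ k.+1) //=; last by lia.
rewrite [X in _ + X]big_nat_cond [X in _ + X]big1 ?addr0; last first.
  move=> t /andP[/andP[kt _] _].
  by rewrite /F (@ifact2_neg (2 * k%:Z + n%:Z - n%:Z - 2 * t%:Z)) ?mulr0 ?mul0r //; lia.
rewrite big_mkord !mulr_sumr; apply: eq_bigr => t _; rewrite !mxE.
suff -> : F t = (-1) ^+ t * racah_weight k q t * (((n - k)`!)%:R)^-1 *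
   (if (i' + (k - t) == i + absz (k%:Z - t%:Z - q)%R)%N && (k - t <= i)%N
    then ('C(n - k, i - (k - t)))%:R else 0).
  by case: ifP => _; ring.
have le_t : (t <= k)%N by rewrite -ltnS.
rewrite /F /racah_weight; case: ifP => [/andP[a0 ak]|/negbT]; last first.
  rewrite negb_and -!ltNge => /orP[h|h].
    by rewrite (@ifact2_neg (2 * k%:Z - 2 * q - 2 * t%:Z)) ?mulr0 ?mul0r //; lia.
  by rewrite (@ifact2_neg (n%:Z - n%:Z + 2 * q + 2 * t%:Z)) ?mulr0 ?mul0r //; lia.
set a := absz (k%:Z - t%:Z - q)%R in a0 ak *.
have -> : (i' + (k - t) == i + a)%N by apply/eqP; lia.
case: (leqP (k - t) i) => bi /=; last first.
  by rewrite (@ifact2_neg (n%:Z - 2 * k%:Z - _ + _)) ?mulr0 ?mul0r //; lia.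
case: (leqP t (n - i)) => ti; last first.
  rewrite [in RHS]bin_small ?mulr0; last by lia.
  by rewrite (@ifact2_neg (n%:Z + (n%:Z - 2 * i%:Z) - 2 * t%:Z)) ?mulr0 ?mul0r //; lia.
rewrite (@ifact2_double _ t) // (@ifact2_double _ (k - t)); last by lia.
rewrite (@ifact2_double _ a); last by lia.
rewrite (@ifact2_double _ (n - i - t)); last by lia.
rewrite (@ifact2_double _ (k - a)); last by lia.
rewrite (@ifact2_double _ (i - (k - t))); last by lia.
have le_b : (i - (k - t) <= n - k)%N by lia.
rewrite -(bin_fact le_b) (_ : (n - k - (i - (k - t)) = n - i - t)%N); last by lia.
have nzb : ('C(n - k, i - (k - t)))%:R != 0 :> C by rewrite pnatr_eq0 -lt0n bin_gt0.
by rewrite !natrM; field; rewrite nzb !fact_neq0.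
Qed.

(** * Bivariate generating polynomials of operators *)

Section Bicoef.
Variable n : nat.

(* 'X (outer variable) marks the ones of the row bit string, and the inner
   variable those of the column bit string. *)
Definition bicoef_mx (F : {poly {poly C}}) : 'M[C]_n.+1 :=
  \matrix_(i', i) (dicke_amp n i' * dicke_amp n i * F`_i'`_i).

Lemma bicoef_mxD F F' : bicoef_mx (F + F') = bicoef_mx F + bicoef_mx F'.
Proof. by apply/matrixP => i' i; rewrite !mxE !coefD mulrDr. Qed.

Lemma bicoef_mxZ c F : bicoef_mx (c%:P%:P * F) = c *: bicoef_mx F.
Proof. by apply/matrixP => i' i; rewrite !mxE !coefCM; ring. Qed.

Definition bimonom (a b : nat) : {poly {poly C}} := 'X^a * ('X^b)%:P.

Lemma bimonomD a b a' b' : bimonom a b * bimonom a' b' = bimonom (a + a') (b + b').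
Proof. by rewrite /bimonom !exprD polyCM; ring. Qed.

Lemma bimonom_coef a b i' i :
  (bimonom a b)`_i'`_i = if (i' == a) && (i == b) then 1 else 0.
Proof.
rewrite /bimonom coefMC coefXn; case: eqP => _; last by rewrite mul0r coef0.
by rewrite mul1r coefXn; case: eqP.
Qed.

(** The identity on one qubit has generating polynomial [1 + bimonom 1 1]. The coefficient picks the
    term with i - b ones on the free qubits. *)
Lemma bicoef_mx_unit k a b :
  bicoef_mx ((1 + bimonom 1 1) ^+ (n - k) * bimonom a b) = dicke_unit n k a b.
Proof.
have pow11 j : bimonom 1 1 ^+ j = bimonom j j.
  by elim: j => [|j IH]; rewrite ?exprS ?IH ?bimonomD // /bimonom !expr0 mulr1.
apply/matrixP => i' i; rewrite !mxE exprDn mulr_suml !coef_sum.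
have E (j : 'I_(n - k).+1) :
    (1 ^+ (n - k - j) * bimonom 1 1 ^+ j *+ 'C(n - k, j) * bimonom a b)`_i'`_i =
    if (i' + b == i + a)%N && (b <= i)%N && (j == i - b :> nat)%N
    then ('C(n - k, i - b))%:R else 0 :> C.
  rewrite expr1n mul1r pow11 mulrnAl bimonomD coefMn coefMn bimonom_coef.
  case: ifP => [/andP[/eqP e1 /eqP e2]|h].
    have -> : (j : nat) = (i - b)%N by lia.
    by rewrite eqxx ifT //; lia.
  by rewrite mul0rn ifF //; lia.
rewrite (eq_bigr _ (fun j _ => E j)).
case: ifP => [c|c] /=; last by rewrite big1 ?mulr0.
rewrite -big_mkcond /=; congr (_ * _).
case: (ltnP (i - b) (n - k).+1) => h.
  by rewrite (big_pred1 (Ordinal h)).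
rewrite big_pred0 ?bin_small // => j.
by apply/eqP => jb; move: (ltn_ord j); rewrite jb ltnNge h.
Qed.

(** Generating polynomial of a one-qubit operator, nested so that [coef_prod_linear] applies once to
    rows and once to columns. *)
Definition bilin (e : bool -> bool -> C) : {poly {poly C}} :=
  ((e true true)%:P * 'X + (e true false)%:P)%:P * 'X
  + ((e false true)%:P * 'X + (e false false)%:P)%:P.

Lemma bilinE e : bilin e =
  (e true true)%:P%:P * bimonom 1 1 + (e true false)%:P%:P * bimonom 1 0 +
  (e false true)%:P%:P * bimonom 0 1 + (e false false)%:P%:P * bimonom 0 0.
Proof.
by rewrite /bilin /bimonom !expr0 !expr1 !polyCD !polyCM; ring.
Qed.

Lemma dicke_op_qtensor (f : 'I_n -> 'M[C]_2) :
  dicke_op (qtensor f) =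
  bicoef_mx (\prod_l bilin (fun c d => f l (bidx c) (bidx d))).
Proof.
apply/matrixP => i' i; rewrite !mxE; congr (_ * _).
have H (s : bits n) := coef_prod_linear (fun l d => f l (bidx (s l)) (bidx d)) true i.
have := coef_prod_linear (fun l c => (f l (bidx c) (bidx true))%:P * 'X +
   (f l (bidx c) (bidx false))%:P) true i'.
rewrite -/(bits n) /= => E.
transitivity ((\sum_(s : bits n | #|[pred l | s l == true]| == i')
   \prod_l ((f l (bidx (s l)) (bidx true))%:P * 'X + (f l (bidx (s l)) (bidx false))%:P))`_i);
 last by rewrite -E.
rewrite coef_sum; apply: eq_big => [s|s _]; first by rewrite card_ones.
rewrite (H s); by apply: eq_bigl => t; rewrite card_ones.
Qed.

End Bicoef.

(** * Linear predicates, standing for the Knill-Laflamme condition: from spherical tensors to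
    Paulis *)

Section LinearPredicate.
Variables (n : nat) (P : 'M[C]_n.+1 -> Prop).
Hypothesis P_lin : forall c M N, P M -> P N -> P (c *: M + N).
Hypothesis P0 : P 0.

Lemma linpredZ c M : P M -> P (c *: M).
Proof. by move=> PM; rewrite -[c *: M]addr0; apply: P_lin. Qed.

Lemma linpredD M N : P M -> P N -> P (M + N).
Proof. by move=> PM PN; rewrite -[M]scale1r; apply: P_lin. Qed.

Lemma linpredB M N : P M -> P N -> P (M - N).
Proof. by move=> PM PN; rewrite addrC -scaleN1r; apply: P_lin. Qed.

Lemma linpred_sum I (r : seq I) (Q : pred I) (F : I -> 'M[C]_n.+1) :
  (forall i, Q i -> P (F i)) -> P (\sum_(i <- r | Q i) F i).
Proof. by move=> PF; apply: big_ind => //; exact: linpredD. Qed.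

(** Each factor raises either exponent by at most one. [F] is general because it absorbs the factors
    already treated. *)
Lemma linpred_bilin_prod I (r : seq I) (e : I -> bool -> bool -> C) F :
  (forall a b, (a <= size r)%N -> (b <= size r)%N -> P (bicoef_mx n (F * bimonom a b))) ->
  P (bicoef_mx n (F * \prod_(l <- r) bilin (e l))).
Proof.
elim: r F => [|l r IH] F PF.
  by rewrite big_nil; have := PF 0 0 isT isT; rewrite /bimonom !expr0 mulr1.
rewrite big_cons mulrA; apply: IH => a b ale ble.
rewrite bilinE.
have -> : F * ((e l true true)%:P%:P * bimonom 1 1 + (e l true false)%:P%:P * bimonom 1 0 +
  (e l false true)%:P%:P * bimonom 0 1 + (e l false false)%:P%:P * bimonom 0 0) * bimonom a b
 = (e l true true)%:P%:P * (F * (bimonom 1 1 * bimonom a b))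
  + ((e l true false)%:P%:P * (F * (bimonom 1 0 * bimonom a b))
  + ((e l false true)%:P%:P * (F * (bimonom 0 1 * bimonom a b))
  + (e l false false)%:P%:P * (F * (bimonom 0 0 * bimonom a b)))) by ring.
rewrite !bicoef_mxD !bicoef_mxZ !bimonomD !add0n !add1n.
by apply: (P_lin _ _ (P_lin _ _ (P_lin _ _ (linpredZ _ _)))); apply: PF;
  rewrite //= ltnW.
Qed.

(** Identity factors give the power of [1 + bimonom 1 1]; the others expand into monomials of degree
    at most the weight in each variable. *)
Lemma linpred_pauli (Q : 'I_n -> 'I_4) :
  (forall a b, (a <= pauli_weight Q)%N -> (b <= pauli_weight Q)%N ->
     P (dicke_unit n (pauli_weight Q) a b)) ->
  P (dicke_op (@pauli C n Q)).
Proof.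
move=> PU; rewrite /pauli dicke_op_qtensor (bigID [pred i | Q i == 0]) /=.
have -> : \prod_(l | Q l == 0) bilin (fun c d => pauli1 C (Q l) (bidx c) (bidx d)) =
    (1 + bimonom 1 1) ^+ (n - pauli_weight Q).
  have e : (pauli_weight Q + #|[predC [pred i | (Q i != 0)%R]]| = n)%N.
    by rewrite cardC card_ord.
  rewrite -[X in (X - _)%N]e addKn -prodr_const.
  apply: eq_big => l; first by rewrite !inE negbK.
  move=> /eqP ->; rewrite bilinE !mxE !bidxE /= !polyC1 !polyC0 /bimonom !expr0 !expr1.
  by rewrite polyC1; ring.
rewrite -(big_enum _ _ [pred i | Q i != 0]) /=.
apply: linpred_bilin_prod => a b; rewrite -cardE => ale ble.
by rewrite bicoef_mx_unit; apply: PU.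
Qed.

Lemma linpred_dicke_unit_shift k a b m :
  (forall a b, (a < k)%N -> (b < k)%N -> P (dicke_unit n k.-1 a b)) ->
  (k <= n)%N -> (a + m <= k)%N -> (b + m <= k)%N ->
  P (dicke_unit n k (a + m) (b + m) - (-1) ^+ m *: dicke_unit n k a b).
Proof.
move=> IH kn; elim: m => [|m IHm]; first by rewrite !addn0 expr0 scale1r subrr.
rewrite !addnS => ale ble.
have -> : dicke_unit n k (a + m).+1 (b + m).+1 - (-1) ^+ m.+1 *: dicke_unit n k a b =
    dicke_unit n k.-1 (a + m) (b + m) -
    (dicke_unit n k (a + m) (b + m) - (-1) ^+ m *: dicke_unit n k a b).
  (* The bound on a + m + 1 excludes k = 0, where [k.-1] would not be a lower level. *)
  case: k {IH IHm} kn ale ble => // k kn _ _.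
  rewrite (dicke_unit_pascal _ _ kn) exprS mulN1r scaleNr opprK opprB addrA.
  by rewrite addrAC addrK addrC.
apply: linpredB; first exact: IH.
by apply: IHm; exact: ltnW.
Qed.

(** Shift from the unit with the smaller column index to the other; b + b' has the parity of the
    shift. *)
Lemma linpred_dicke_unit_diag k a b a' b' :
  (forall a b, (a < k)%N -> (b < k)%N -> P (dicke_unit n k.-1 a b)) ->
  (k <= n)%N -> (a <= k)%N -> (b <= k)%N -> (a' <= k)%N -> (b' <= k)%N ->
  (a + b' = a' + b)%N ->
  P (dicke_unit n k a b - (-1) ^+ (b + b') *: dicke_unit n k a' b').
Proof.
move=> IH kn ak bk ak' bk' e.
case: (leqP b b') => bb.
  have := @linpred_dicke_unit_shift k a b (b' - b) IH kn.
  have -> : (a + (b' - b) = a')%N by lia.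
  (* The shift gives the difference in the reverse order; scaling by minus its sign swaps the two
     units. *)
  rewrite subnKC // => /(_ ak' bk') /(linpredZ (- (-1) ^+ (b' - b))).
  rewrite scalerBr scalerA mulNr -exprD addnn -mul2n exprM sqrrN expr1n expr1n.
  rewrite scaleN1r opprK scaleNr addrC.
  have -> : (b + b' = (b' - b) + 2 * b)%N by lia.
  by rewrite exprD exprM sqrrN expr1n expr1n mulr1.
have := @linpred_dicke_unit_shift k a' b' (b - b') IH kn.
have -> : (a' + (b - b') = a)%N by lia.
rewrite (subnKC (ltnW bb)) => /(_ ak bk).
have -> : (b + b' = (b - b') + 2 * b')%N by lia.
by rewrite exprD exprM sqrrN expr1n expr1n mulr1.
Qed.

(** The sign (-1)^t of Racah's sum times the sign (-1)^(k-t+b) of the move to (a, b) is (-1)^(k+b)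
    for every t, so the weights add up without cancellation. *)
Lemma linpred_dicke_unit w :
  (forall k q, (k <= w)%N -> `|q| <= k%:Z -> P (sph_tensor C n k q)) ->
  forall k a b, (k <= w)%N -> (k <= n)%N -> (a <= k)%N -> (b <= k)%N ->
  P (dicke_unit n k a b).
Proof.
move=> PT k; elim/ltn_ind: k => k IH a b kw kn ak bk.
have IH' a' b' : (a' < k)%N -> (b' < k)%N -> P (dicke_unit n k.-1 a' b').
  by move=> ak' bk'; apply: IH; lia.
have qk : `|b%:Z - a%:Z| <= k%:Z by lia.
have [c c0 Tc] := sph_tensorE kn qk.
have := linpredZ c^-1 (PT k (b%:Z - a%:Z) kw qk).
rewrite Tc scalerA mulVf // scale1r => PS.
set q := b%:Z - a%:Z in PS qk.
pose s := \sum_(t < k.+1) racah_weight k q t.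
have s_gt0 : 0 < s.
  have kb : (k - b < k.+1)%N by lia.
  (* The summand t = k - b is the unit (a, b) itself, so its weight is positive and the sum cannot
     vanish. *)
  rewrite /s (bigD1 (Ordinal kb)) //= ltr_pwDl ?sumr_ge0 //.
    rewrite /racah_weight ifT; last by rewrite /q; apply/andP; split; lia.
    by rewrite invr_gt0 !mulr_gt0 // ltr0n fact_gt0.
  move=> t _; rewrite /racah_weight; case: ifP => // _.
  by rewrite invr_ge0 !mulr_ge0 // ler0n.
have : P ((-1) ^+ (k + b) * s *: dicke_unit n k a b).
  have -> : (-1) ^+ (k + b) * s *: dicke_unit n k a b =
     \sum_(t < k.+1) ((-1) ^+ t * racah_weight k q t)
         *: dicke_unit n k (absz (k%:Z - t%:Z - q)%R) (k - t) -
     \sum_(t < k.+1) ((-1) ^+ t * racah_weight k q t)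
         *: (dicke_unit n k (absz (k%:Z - t%:Z - q)%R) (k - t)
             - (-1) ^+ ((k - t) + b) *: dicke_unit n k a b).
    rewrite -sumrB /s mulr_sumr scaler_suml; apply: eq_bigr => t _.
    rewrite -scalerBr subKr scalerA mulrAC -exprD.
    by rewrite addnA subnKC // -ltnS.
  apply: linpredB => //; apply: linpred_sum => t _.
  have le_t : (t <= k)%N by rewrite -ltnS.
  rewrite /racah_weight; case: ifP => [/andP[a0 ak']|_]; last first.
    by rewrite mulr0 scale0r.
  apply: linpredZ; apply: linpred_dicke_unit_diag => //;
    rewrite /q in a0 ak' *; lia.
move/(linpredZ ((-1) ^+ (k + b) * s)^-1); rewrite scalerA mulVf ?scale1r //.
by rewrite mulf_neq0 ?signr_eq0 // lt0r_neq0.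
Qed.

End LinearPredicate.

End Dicke.

(** * Inner products and the code properties *)

Lemma cdotZr (C : numClosedFieldType) m (c : C) (u v : 'cV[C]_m) :
  cdot u (c *: v) = c * cdot u v.
Proof. by rewrite /cdot mulr_sumr; apply: eq_bigr => i _; rewrite mxE mulrCA. Qed.

Lemma cdotDr (C : numClosedFieldType) m (u v w : 'cV[C]_m) :
  cdot u (v + w) = cdot u v + cdot u w.
Proof. by rewrite /cdot -big_split; apply: eq_bigr => i _; rewrite mxE mulrDr. Qed.

Lemma cdotE (C : numClosedFieldType) m (u v : 'cV[C]_m) :
  cdot u v = (adjmx u *m v) 0 0.
Proof. by rewrite mxE; apply: eq_bigr => i _; rewrite !mxE. Qed.

Lemma cdot_isometry (C : numClosedFieldType) m K (V : 'M[C]_(m, K)) (x y : 'cV[C]_K) :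
  adjmx V *m V = 1%:M -> cdot (V *m x) (V *m y) = cdot x y.
Proof.
move=> VV; rewrite !cdotE /adjmx map_mxM trmx_mul -mulmxA (mulmxA _ V y).
by rewrite -/(adjmx V) VV mul1mx.
Qed.

Lemma cdot_eq0 (C : numClosedFieldType) m (x : 'cV[C]_m) :
  (forall y, cdot x y = 0) -> x = 0.
Proof.
move=> x0; apply/matrixP => i j; rewrite ord1 !mxE.
have := x0 (delta_mx i 0); rewrite /cdot (bigD1 i) //= mxE !eqxx mulr1 big1.
  by rewrite addr0 => /eqP; rewrite conjC_eq0 => /eqP.
by move=> k ki; rewrite mxE (negbTE ki) mulr0.
Qed.

Theorem theorem1
  (C : numClosedFieldType) (gT : finGroupType) (G : {group gT})
  (rho : mx_representation C G 2)
  (rho_faithful : mx_faithful rho)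
  (rho_SU2 : forall a, a \in G ->
      adjmx (rho a) *m rho a = 1%:M /\ \det (rho a) = 1)
  (K : nat) (lam : mx_representation C G K)
  (lam_unitary : forall a, a \in G -> adjmx (lam a) *m lam a = 1%:M)
  (lam_irr : mx_irreducible lam)
  (n d : nat) (V : 'M[C]_(n.+1, K))
  (V_isometry : adjmx V *m V = 1%:M)
  (V_code : @spin_code_distance C n K d V)
  (V_cov : forall a, a \in G -> wignerD n (rho a) *m V = V *m lam a) :
  let W := fun x : 'cV[C]_K => dicke (V *m x) in
  (forall x, perm_invariant (W x)) /\
  (forall x, W x =1 (fun _ => 0) -> x = 0) /\
  @qubit_code_distance C n K d W /\
  (forall a, a \in G -> forall x : 'cV[C]_K,
      qapply (@tpow C n (rho a)) (W x) =1 W (lam a *m x)).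
Proof.
move=> W; split=> [x|]; first exact: dicke_perm_invariant.
split=> [x Wx0|].
  (* [W] preserves inner products, so a vector in its kernel is orthogonal to everything. *)
  apply: cdot_eq0 => y; rewrite -(cdot_isometry _ _ V_isometry) -dicke_isometry.
  by rewrite /qdot big1 // => s _; rewrite -/(W x) Wx0 rmorph0 mul0r.
split=> [Q Qd|a aG x]; last first.
  by move=> s; rewrite dicke_wignerD mulmxA V_cov // -mulmxA.
(* The constant may depend on [M], so constants combine linearly along with the matrices. *)
pose P (M : 'M[C]_n.+1) := exists c : C, forall x y : 'cV[C]_K,
  cdot (V *m x) (M *m (V *m y)) = c * cdot (V *m x) (V *m y).
have P0 : P 0.
  exists 0 => x y; rewrite mul0r mul0mx.
  by rewrite -[X in cdot _ X](scale0r 0) cdotZr mul0r.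
have P_lin c M N : P M -> P N -> P (c *: M + N).
  move=> [m Em] [k Ek]; exists (c * m + k) => x y.
  by rewrite mulmxDl -scalemxAl cdotDr cdotZr Em Ek mulrDl mulrA.
have Qn : (pauli_weight Q <= n)%N by rewrite -[X in (_ <= X)%N]card_ord max_card.
suff [c Ec] : P (dicke_op (@pauli C n Q)).
  by exists c => x y; rewrite /W qdot_dicke_op dicke_isometry.
apply: (linpred_pauli P_lin P0) => a b.
apply: (linpred_dicke_unit P_lin P0 (w := pauli_weight Q)) => // k q kw qk.
(* A rank at most the Pauli weight is below d and at most n, the range covered by the spin code
   condition. *)
by apply: V_code => //; [apply: leq_ltn_trans Qd | apply: leq_trans Qn].
Qed.
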